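(* Let $\mathcal{D}$ be a numerically finite triangulated category with a Serre functor, endowed with a numerical stability condition. Then $\mathcal{D}$ has no nonzero phantomic summands.
   Context: Categories are $\mathbb{C}$-linear. A triangulated category $\mathcal{D}$ with a Serre functor is numerically finite if for any objects $E,F$ one has $\dim\mathrm{Hom}_{\mathcal{D}}(E,F[n])<\infty$ for every $n\in\mathbb{Z}$ and $\mathrm{Hom}_{\mathcal{D}}(E,F[n])=0$ for $|n|\gg0$. $K_{\mathrm{num}}(\mathcal{D})$ is the Grothendieck group $K(\mathcal{D})$ modulo the kernel of the Euler pairing. A (Bridgeland) stability condition $\sigma=(\mathcal{A},Z)$, with $\mathcal{A}$ the heart of a bounded $t$-structure and $Z\colon K(\mathcal{D})\to\mathbb{C}$, is numerical if $Z$ factors through $K_{\mathrm{num}}(\mathcal{D})$. A semiorthogonal decomposition $\mathcal{D}=\langle\mathcal{D}_1,\mathcal{D}_2\rangle$ (so $\mathrm{Hom}(E_2,E_1)=0$ for $E_i\in\mathcal{D}_i$) is called orthogonal, and written $\mathcal{D}=\mathcal{D}_1\oplus\mathcal{D}_2$, if also $\mathrm{Hom}(E_1,E_2)=0$ for all $E_1\in\mathcal{D}_1$, $E_2\in\mathcal{D}_2$. A triangulated subcategory $\mathcal{D}_{\mathrm{phan}}$ of $\mathcal{D}$ is a phantomic summand if (1) there exists an orthogonal decomposition $\mathcal{D}=\mathcal{D}_{\mathrm{body}}\oplus\mathcal{D}_{\mathrm{phan}}$; and (2) for every object $E$ in $\mathcal{D}_{\mathrm{phan}}$ one has $[E]=0$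 in $K_{\mathrm{num}}(\mathcal{D})$ (i.e. $K_{\mathrm{num}}(\mathcal{D}_{\mathrm{phan}})=0$). *)

(* Defs.v *)
From HB Require Import structures.
From mathcomp Require Import all_boot all_order all_algebra.
From mathcomp Require Import generic_quotient ring_quotient.
From mathcomp Require Import boolp classical_sets functions cardinality.
From mathcomp Require Import fsbigop reals trigo zify.
From mathcomp.real_closed Require Import complex.
From mathcomp.multinomials Require Import freeg.
Set Implicit Arguments.
Unset Strict Implicit.
Unset Printing Implicit Defensive.

Import Order.TTheory GRing.Theory Num.Theory.

Local Open Scope quotient_scope.
Local Open Scope classical_set_scope.
Local Open Scope ring_scope.

Record lincat (k : fieldType) := LinCat {
  ob :> Type;
  hom : ob -> ob -> lmodType k;
  idm : forall A, hom A A;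
  comp : forall A B C, hom B C -> hom A B -> hom A C;
  comp1m : forall A B (f : hom A B), comp (idm B) f = f;
  compm1 : forall A B (f : hom A B), comp f (idm A) = f;
  compA : forall A B C E (h : hom C E) (g : hom B C) (f : hom A B),
    comp h (comp g f) = comp (comp h g) f;
  compPl : forall A B C a (g g' : hom B C) (f : hom A B),
    comp (a *: g + g') f = a *: comp g f + comp g' f;
  compPr : forall A B C a (g : hom B C) (f f' : hom A B),
    comp g (a *: f + f') = a *: comp g f + comp g f'
}.

Arguments hom {k} _ _ _.
Arguments idm {k} _ _.
Arguments comp {k _ A B C} _ _.

Notation "A ~> B" := (hom _ A B) (at level 70) : ring_scope.
Notation "g \oc f" := (comp g f) (at level 48, left associativity) : ring_scope.

Section LinearCategory.
Variables (k : fieldType) (D : lincat k).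
Implicit Types A B C : D.

Definition is_iso A B (f : A ~> B) : Prop :=
  exists2 g : B ~> A, g \oc f = idm D A & f \oc g = idm D B.

Definition isomorphic A B : Prop := exists f : A ~> B, is_iso f.

Definition is_zero A : Prop :=
  forall B, (forall f : A ~> B, f = 0) /\ (forall f : B ~> A, f = 0).

Definition is_biproduct A B P (iA : A ~> P) (iB : B ~> P)
    (pA : P ~> A) (pB : P ~> B) : Prop :=
  [/\ pA \oc iA = idm D A, pB \oc iB = idm D B, pA \oc iB = 0,
      pB \oc iA = 0 & iA \oc pA + iB \oc pB = idm D P].

Definition additive_cat : Prop :=
  (exists Z : D, is_zero Z) /\
  (forall A B, exists P (iA : A ~> P) (iB : B ~> P) (pA : P ~> A)
     (pB : P ~> B), is_biproduct iA iB pA pB).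

(** Monomorphisms and short exact sequences in a full subcategory [H],
    given by its objects. *)

Definition mono_in (H : D -> Prop) A B (i : A ~> B) : Prop :=
  forall X (u v : X ~> A), H X -> i \oc u = i \oc v -> u = v.

Definition kernel_in (H : D -> Prop) A B C (i : A ~> B) (p : B ~> C) : Prop :=
  p \oc i = 0 /\
  forall X (u : X ~> B), H X -> p \oc u = 0 -> exists! v, i \oc v = u.

Definition cokernel_in (H : D -> Prop) A B C (i : A ~> B) (p : B ~> C) : Prop :=
  p \oc i = 0 /\
  forall X (u : B ~> X), H X -> u \oc i = 0 -> exists! v, v \oc p = u.

Definition short_exact_in (H : D -> Prop) A B C (i : A ~> B) (p : B ~> C) :=
  [/\ H A, H B, H C, kernel_in H i p & cokernel_in H i p].

End LinearCategory.

Record linfun_cat (k : fieldType) (D E : lincat k) := LinFunctor {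
  fob :> D -> E;
  fmor : forall A B : D, (A ~> B) -> (fob A ~> fob B);
  fmor1 : forall A : D, fmor (idm D A) = idm E (fob A);
  fmorM : forall (A B C : D) (g : B ~> C) (f : A ~> B),
    fmor (g \oc f) = fmor g \oc fmor f;
  fmorP : forall (A B : D) a (f f' : A ~> B),
    fmor (a *: f + f') = a *: fmor f + fmor f'
}.

Arguments fmor {k D E} _ {A B} _.

Section Functors.
Variable k : fieldType.

Definition idF (D : lincat k) : linfun_cat D D.
Proof. by exists id (fun A B f => f). Defined.

Definition compF (C D E : lincat k) (G : linfun_cat D E) (F : linfun_cat C D) :
  linfun_cat C E.
Proof.
exists (fun A => G (F A)) (fun A B f => fmor G (fmor F f)).
- by move=> A; rewrite !fmor1.
- by move=> *; rewrite !fmorM.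
- by move=> *; rewrite !fmorP.
Defined.

Definition nat_isomorphic (D E : lincat k) (F G : linfun_cat D E) : Prop :=
  exists eta : forall A, F A ~> G A,
    (forall A, is_iso (eta A)) /\
    (forall A B (f : A ~> B), eta B \oc fmor F f = fmor G f \oc eta A).

Definition quasi_inverse (D E : lincat k)
    (F : linfun_cat D E) (G : linfun_cat E D) : Prop :=
  nat_isomorphic (compF G F) (idF D) /\ nat_isomorphic (compF F G) (idF E).

End Functors.

(** The shift is an autoequivalence, not necessarily a strict automorphism;
    [unshift] is a chosen quasi-inverse, written [-1]. *)

Record tricat (k : fieldType) := TriCat {
  tcat :> lincat k;
  tri_additive : additive_cat tcat;
  shift : linfun_cat tcat tcat;
  unshift : linfun_cat tcat tcat;
  shiftK : quasi_inverse shift unshift;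
  dist : forall A B C : tcat,
    (A ~> B) -> (B ~> C) -> (C ~> shift A) -> Prop;
  (* TR1 *)
  dist_iso : forall (A B C A' B' C' : tcat)
      (f : A ~> B) (g : B ~> C) (h : C ~> shift A)
      (f' : A' ~> B') (g' : B' ~> C') (h' : C' ~> shift A')
      (a : A ~> A') (b : B ~> B') (c : C ~> C'),
    is_iso a -> is_iso b -> is_iso c ->
    b \oc f = f' \oc a -> c \oc g = g' \oc b ->
    fmor shift a \oc h = h' \oc c ->
    dist f g h -> dist f' g' h';
  dist_id : forall A Z : tcat, is_zero Z ->
    dist (idm tcat A) (0 : A ~> Z) (0 : Z ~> shift A);
  dist_cone : forall (A B : tcat) (f : A ~> B),
    exists (C : tcat) (g : B ~> C) (h : C ~> shift A), dist f g h;
  (* TR2 *)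
  dist_rot : forall (A B C : tcat)
      (f : A ~> B) (g : B ~> C) (h : C ~> shift A),
    dist f g h <-> dist g h (- fmor shift f);
  (* TR3 *)
  dist_mor : forall (A B C A' B' C' : tcat)
      (f : A ~> B) (g : B ~> C) (h : C ~> shift A)
      (f' : A' ~> B') (g' : B' ~> C') (h' : C' ~> shift A')
      (a : A ~> A') (b : B ~> B'),
    dist f g h -> dist f' g' h' -> b \oc f = f' \oc a ->
    exists2 c : C ~> C',
      c \oc g = g' \oc b & fmor shift a \oc h = h' \oc c;
  (* TR4 *)
  dist_octahedron : forall (X Y Z Q1 Q2 Q3 : tcat)
      (f : X ~> Y) (g : Y ~> Z)
      (p1 : Y ~> Q1) (d1 : Q1 ~> shift X)
      (p2 : Z ~> Q2) (d2 : Q2 ~> shift X)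
      (p3 : Z ~> Q3) (d3 : Q3 ~> shift Y),
    dist f p1 d1 -> dist (g \oc f) p2 d2 -> dist g p3 d3 ->
    exists (a : Q1 ~> Q2) (b : Q2 ~> Q3),
      [/\ dist a b (fmor shift p1 \oc d3),
          a \oc p1 = p2 \oc g, d2 \oc a = d1,
          b \oc p2 = p3 & d3 \oc b = fmor shift f \oc d2]
}.

Arguments shift {k} _.
Arguments unshift {k} _.
Arguments dist {k _ A B C} _ _ _.

Definition shiftn (k : fieldType) (D : tricat k) (n : int) (A : D) : D :=
  match n with
  | Posz m => iter m (shift D) A
  | Negz m => iter m.+1 (unshift D) A
  end.

(** [serre_map E F] is the isomorphism Hom(E,F) -> Hom(F,SE)^* , natural in
    both variables. *)

Record serre_functor (k : fieldType) (D : lincat k) := SerreFunctor {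
  serre :> linfun_cat D D;
  serre_equiv : exists T : linfun_cat D D, quasi_inverse serre T;
  serre_map : forall E F : D, (E ~> F) -> {linear (F ~> serre E) -> k^o};
  serre_mapP : forall (E F : D) a (f f' : E ~> F) (g : F ~> serre E),
    serre_map (a *: f + f') g = a *: serre_map f g + serre_map f' g;
  serre_bij : forall (E F : D) (phi : {linear (F ~> serre E) -> k^o}),
    exists! f : E ~> F, forall g, serre_map f g = phi g;
  serre_natl : forall (E' E F : D) (a : E' ~> E) (f : E ~> F)
      (g : F ~> serre E'),
    serre_map (f \oc a) g = serre_map f (fmor serre a \oc g);
  serre_natr : forall (E F F' : D) (b : F ~> F') (f : E ~> F)
      (g : F' ~> serre E),
    serre_map (b \oc f) g = serre_map f (g \oc b)
}.

Section Dimension.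
Variables (k : fieldType) (V : lmodType k).

Definition has_dim (n : nat) : Prop :=
  exists f : {linear V -> 'rV[k]_n}, bijective f.

Definition fin_dim : Prop := exists n, has_dim n.

(* Meaningful only when [fin_dim] holds; 0 otherwise. *)
Definition dim : nat := xget 0%N [set n | has_dim n].

End Dimension.

Definition numerically_finite (k : fieldType) (D : tricat k) : Prop :=
  forall E F : D,
    (forall n : int, fin_dim (hom D E (shiftn n F))) /\
    (exists N : nat, forall n : int, (N < `|n|)%N ->
       forall f : E ~> shiftn n F, f = 0).

Section LinearAlgebra.
Variable k : fieldType.
Implicit Types U V W : lmodType k.

Lemma fin_dimP V : fin_dim V -> has_dim V (dim V).
Proof. by case=> n hn; exact: (xgetI 0%N (hn : [set n | has_dim V n] n)). Qed.

Lemma linear_inverse V W (f : {linear V -> W}) (g : W -> V) :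
  cancel f g -> cancel g f -> exists g' : {linear W -> V}, g' =1 g.
Proof.
move=> fK gK.
have gl : linear g.
  by move=> a u v; rewrite -[u in LHS]gK -[v in LHS]gK -linearP fK.
pose gL : {linear W -> V} :=
  HB.pack (g : W -> V) (GRing.isLinear.Build k W V *:%R g gl).
by exists gL.
Qed.

Lemma dim_iso V W (f : {linear V -> W}) : bijective f -> dim V = dim W.
Proof.
case=> g fK gK; have [g' g'E] := linear_inverse fK gK.
congr xget; apply/seteqP; split=> n /= [h [h' hK h'K]].
- exists (h \o g'); exists (f \o h') => x /=; rewrite g'E; first by rewrite hK gK.
  by rewrite fK h'K.
- exists (h \o f); exists (g \o h') => x /=; first by rewrite hK fK.
  by rewrite gK h'K.
Qed.

Lemma dim0 V : fin_dim V -> (forall v : V, v = 0) -> dim V = 0%N.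
Proof.
move=> /fin_dimP[f [g fK gK]] V0; case: (dim V) f g fK gK => // n f g _ gK.
have := gK (const_mx 1); rewrite (V0 (g _)) linear0 => /rowP/(_ ord0).
by rewrite !mxE => /eqP; rewrite eq_sym oner_eq0.
Qed.

Definition crd V (hV : fin_dim V) : {linear V -> 'rV[k]_(dim V)} :=
  sval (cid (fin_dimP hV)).

Lemma crd_inv V (hV : fin_dim V) : exists g : {linear 'rV[k]_(dim V) -> V},
  cancel (crd hV) g /\ cancel g (crd hV).
Proof.
rewrite /crd; case: (cid _) => /= f [g fK gK].
by have [g' g'E] := linear_inverse fK gK; exists g'; split=> x; rewrite g'E.
Qed.

Definition crdV V (hV : fin_dim V) : {linear 'rV[k]_(dim V) -> V} :=
  sval (cid (crd_inv hV)).

Lemma crdK V (hV : fin_dim V) : cancel (crd hV) (crdV hV).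
Proof. by rewrite /crdV; case: (cid _) => ? []. Qed.

Lemma crdVK V (hV : fin_dim V) : cancel (crdV hV) (crd hV).
Proof. by rewrite /crdV; case: (cid _) => ? []. Qed.

Definition lmat V W hV hW (f : {linear V -> W}) :=
  lin1_mx (crd (V:=W) hW \o f \o crdV (V:=V) hV).

Lemma lmatE V W hV hW (f : {linear V -> W}) v :
  crd hW (f v) = crd hV v *m lmat hV hW f.
Proof. by rewrite mul_rV_lin1 /= crdK. Qed.

Definition lrank V W hV hW (f : {linear V -> W}) := \rank (lmat hV hW f).

Lemma lrank_le V W hV hW (f : {linear V -> W}) : (lrank hV hW f <= dim V)%N.
Proof. exact: rank_leq_row. Qed.

Lemma dim_exact U V W hU hV hW (f : {linear U -> V}) (g : {linear V -> W}) :
    (forall v, g v = 0 <-> exists u, f u = v) ->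
  dim V = (lrank hU hV f + lrank hV hW g)%N.
Proof.
move=> ex; have -> : lrank hU hV f = \rank (kermx (lmat hV hW g)).
  apply: eqmx_rank; apply/andP; split.
    apply/sub_kermxP/row_matrixP=> i; rewrite row0 row_mul rowE.
    rewrite -[delta_mx _ _](crdVK hU) -!lmatE.
    by rewrite (proj2 (ex _)) ?linear0 //; eexists.
  apply/row_subP => i; set w := row i _.
  have /sub_kermxP w0 : (w <= kermx (lmat hV hW g))%MS by exact: row_sub.
  have /ex[u uw] : g (crdV hV w) = 0.
    by apply: (can_inj (crdK hW)); rewrite linear0 lmatE crdVK.
  by rewrite -(crdVK hV w) -uw lmatE submxMl.
by rewrite mxrank_ker subnK ?rank_leq_row.
Qed.

Lemma lmat_unit V W hV hW (f : {linear V -> W}) : bijective f ->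
  row_free (lmat hV hW f) /\ row_full (lmat hV hW f).
Proof.
case=> g fK gK; have [g' g'E] := linear_inverse fK gK.
split; [apply/row_freeP | apply/row_fullP]; exists (lmat hW hV g');
  apply/row_matrixP => i; rewrite !rowE mulmxA mulmx1; set w := delta_mx _ _.
  by rewrite -[w](crdVK hV) -!lmatE g'E fK.
by rewrite -[w](crdVK hW) -!lmatE g'E gK.
Qed.

Lemma lrank_iso V W V' W' hV hW hV' hW' (f : {linear V -> W})
    (f' : {linear V' -> W'}) (a : {linear V -> V'}) (b : {linear W -> W'}) :
  bijective a -> bijective b -> (forall v, b (f v) = f' (a v)) ->
  lrank hV hW f = lrank hV' hW' f'.
Proof.
move=> abij bbij sq.
have [_ afull] := lmat_unit hV hV' abij; have [bfree _] := lmat_unit hW hW' bbij.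
rewrite /lrank -(mxrankMfree _ bfree) -(eqmxMfull _ afull); congr (\rank _).
apply/row_matrixP => i; rewrite !rowE !mulmxA -[delta_mx _ _](crdVK hV).
by rewrite -!lmatE sq.
Qed.

End LinearAlgebra.

Section CategoryLemmas.
Variables (k : fieldType) (D : lincat k).
Implicit Types A B C : D.

Lemma comp0m A B C (f : A ~> B) : (0 : B ~> C) \oc f = 0.
Proof.
by have := compPl 1 (0 : B ~> C) 0 f;
  rewrite !scale1r addr0 => /esym/eqP; rewrite -subr_eq0 addrK => /eqP.
Qed.

Lemma compm0 A B C (g : B ~> C) : g \oc (0 : A ~> B) = 0.
Proof.
by have := compPr 1 g (0 : A ~> B) 0;
  rewrite !scale1r addr0 => /esym/eqP; rewrite -subr_eq0 addrK => /eqP.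
Qed.

Lemma compmN A B C (g : B ~> C) (f : A ~> B) : g \oc (- f) = - (g \oc f).
Proof. by have := compPr (-1) g f 0; rewrite !scaleN1r !addr0 compm0 addr0. Qed.

Lemma compNm A B C (g : B ~> C) (f : A ~> B) : (- g) \oc f = - (g \oc f).
Proof. by have := compPl (-1) g 0 f; rewrite !scaleN1r !addr0 comp0m addr0. Qed.

Lemma precomp_linear A B G (f : A ~> B) :
  linear (fun u : B ~> G => u \oc f).
Proof. by move=> a u v; exact: compPl. Qed.

Definition precomp A B G (f : A ~> B) : {linear hom D B G -> hom D A G} :=
  HB.pack (fun u : B ~> G => u \oc f)
    (GRing.isLinear.Build k (hom D B G) (hom D A G) *:%R _
       (@precomp_linear A B G f)).

End CategoryLemmas.

Section FunctorLemmas.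
Variables (k : fieldType) (D E : lincat k) (F : linfun_cat D E).

Lemma fmor0 (A B : D) : fmor F (0 : A ~> B) = 0.
Proof.
by have := fmorP F 1 (0 : A ~> B) 0;
  rewrite !scale1r addr0 => /esym/eqP; rewrite -subr_eq0 addrK => /eqP.
Qed.

Lemma fmor_zero (A : D) : is_zero A -> is_zero (F A).
Proof.
move=> A0 B; have id0 : idm E (F A) = 0 by rewrite -fmor1 ((A0 A).1 (idm D A)) fmor0.
by split=> f; [rewrite -[f]compm1 id0 compm0 | rewrite -[f]comp1m id0 comp0m].
Qed.

Lemma quasi_inverse_inj (G : linfun_cat E D) (A B : D) :
  nat_isomorphic (compF G F) (idF D) -> injective (@fmor _ _ _ F A B).
Proof.
case=> eta [etaI etaN] f g fg; have [t _ tK] := etaI A.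
rewrite -[f]compm1 -tK compA.
have /= <- := etaN _ _ f; rewrite fg; have /= -> := etaN _ _ g.
by rewrite -compA tK compm1.
Qed.

End FunctorLemmas.

Lemma quasi_inverse_surj (k : fieldType) (D E : lincat k) (F : linfun_cat D E)
    (G : linfun_cat E D) (A B : D) (u : F A ~> F B) :
  quasi_inverse F G -> exists v, fmor F v = u.
Proof.
case=> -[eta [etaI etaN]] FG; have [t tK Kt] := etaI A; have [s sK Ks] := etaI B.
exists (eta B \oc fmor G u \oc t); apply: (quasi_inverse_inj FG).
set v := _ \oc t; have /= e := etaN _ _ v.
rewrite -[LHS]comp1m -sK -compA e /v -!compA tK compm1 !compA sK comp1m //.
Qed.

Section CohomologicalHom.
Variables (k : fieldType) (D : tricat k).
Implicit Types A B C : D.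

Lemma dist_comp0 A B C (f : A ~> B) (g : B ~> C) (h : C ~> shift D A) :
  dist f g h -> g \oc f = 0.
Proof.
move=> fgh; have [[Z Z0] _] := tri_additive D.
have [|c e _] := dist_mor (a := idm D A) (b := f) (dist_id A Z0) fgh.
  by rewrite !compm1.
by rewrite -e compm0.
Qed.

Lemma dist_factor A B C (f : A ~> B) (g : B ~> C) (h : C ~> shift D A)
  G (u : B ~> G) : dist f g h -> u \oc f = 0 -> exists v, v \oc g = u.
Proof.
move=> fgh uf0; have [[Z Z0] _] := tri_additive D.
have d : dist (0 : Z ~> G) (idm D G) (0 : G ~> shift D Z).
  apply/dist_rot; rewrite fmor0 oppr0; have SZ0 := fmor_zero (shift D) Z0.
  exact: dist_id.
have [|c e _] := dist_mor (a := (0 : A ~> Z)) (b := u) fgh d.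
  by rewrite uf0 comp0m.
by exists c; rewrite e comp1m.
Qed.

Lemma dist_exact A B C (f : A ~> B) (g : B ~> C) (h : C ~> shift D A) G :
  dist f g h -> forall v, precomp G f v = 0 <-> exists u, precomp G g u = v.
Proof.
move=> fgh v; split=> [/(dist_factor fgh)//|[u <-]] /=.
by rewrite -compA (dist_comp0 fgh) compm0.
Qed.

Lemma dist_exact_shift A B C (f : A ~> B) (g : B ~> C) (h : C ~> shift D A) G :
  dist f g h ->
  forall v, precomp G h v = 0 <-> exists u, precomp G (fmor (shift D) f) u = v.
Proof.
move=> /dist_rot/dist_rot/dist_exact ex v; rewrite ex.
by split=> -[u <-]; exists (- u); rewrite /= compNm compmN ?opprK.
Qed.

Lemma shiftn_succ (F : D) (n : int) :
  isomorphic (shift D (shiftn n F)) (shiftn (n + 1) F).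
Proof.
have [_ [eps [epsI _]]] := shiftK D.
have id_iso (X : D) : isomorphic X X.
  by exists (idm D X), (idm D X); rewrite comp1m.
case: n => [n|[|n]]; first by rewrite -PoszD addn1; exact: id_iso.
  by exists (eps F); exact: epsI.
have -> : Negz n.+1 + 1 = Negz n by rewrite !NegzE -addn1 PoszD opprD addrNK.
by exists (eps (shiftn (Negz n) F)); exact: epsI.
Qed.

End CohomologicalHom.

(* A finitely supported sum over [int]; such a sum is 0 by convention when
   infinitely many terms are nonzero. *)
Definition euler (k : fieldType) (D : tricat k) (E F : D) : int :=
  \sum_(n \in [set: int]) (-1) ^+ `|n|%N * (dim (hom D E (shiftn n F)))%:Z.

Lemma signZS (n : int) : (-1) ^+ absz (n + 1) = - (-1) ^+ `|n|%N :> int.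
Proof.
case: n => [n|[|n]]; first by rewrite -PoszD addn1 /= exprS mulN1r.
  by [].
have -> : Negz n.+1 + 1 = Negz n by rewrite !NegzE -addn1 PoszD opprD addrNK.
by rewrite [in RHS]exprS mulN1r opprK.
Qed.

Lemma fsum_split (f g : int -> int) (N : nat) :
  (forall n, (N < `|n|)%N -> f n = 0 /\ g n = 0) ->
  \sum_(n \in [set: int]) (f n + g n) =
  \sum_(n \in [set: int]) f n + \sum_(n \in [set: int]) g n.
Proof.
move=> fg0; pose P := [set n : int | (`|n| <= N)%N].
have Pfin : finite_set P.
  apply: (@sub_finite_set _ _ ((fun i : nat => i%:Z - N%:Z) @` `I_(N + N).+1)).
    move=> n; rewrite /P /= => nN; exists (absz (n + N%:Z)) => /=; lia.
  exact/finite_image/finite_II.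
have wd F : (forall n, (N < `|n|)%N -> F n = 0) ->
    \sum_(n \in [set: int]) F n = \sum_(n \in P) F n :> int.
  move=> F0; apply/esym/fsbig_widen => // n [_ /negP]; rewrite -ltnNge.
  exact: F0.
rewrite !wd; first exact: fsbig_split.
- by move=> n /fg0[].
- by move=> n /fg0[].
- by move=> n /fg0[-> ->].
Qed.

Section EulerAdditive.
Variables (k : fieldType) (D : tricat k) (finD : numerically_finite D).

Lemma euler_dist (A B C : D) (f : A ~> B) (g : B ~> C) (h : C ~> shift D A)
  (F : D) : dist f g h -> euler B F = euler A F + euler C F.
Proof.
move=> fgh.
pose G n := shiftn n F.
pose fd X n : fin_dim (hom D X (G n)) := (finD X F).1 n.
pose d X n : int := (dim (hom D X (G n)))%:Z.
pose r X Y (u : X ~> Y) n : int :=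
  (lrank (fd Y n) (fd X n) (precomp (G n) u))%:Z.
pose f1 := fmor (shift D) f.
have dB n : d B n = r _ _ g n + r _ _ f n.
  by rewrite /d (dim_exact (fd C n) (fd B n) (fd A n) (dist_exact fgh)) PoszD.
have dC n : d C n = r _ _ h n + r _ _ g n.
  by rewrite /d (dim_exact (fd (shift D A) n) (fd C n) (fd B n)
    (dist_exact ((dist_rot _ _ _).1 fgh))) PoszD.
have dA1 n : d (shift D A) n = r _ _ f1 n + r _ _ h n.
  by rewrite /d (dim_exact (fd (shift D B) n) (fd (shift D A) n) (fd C n)
    (dist_exact_shift fgh)) PoszD.
have shiftE n : exists phi : forall X,
    {linear hom D X (G n) -> hom D (shift D X) (G (n + 1))},
    (forall X, bijective (phi X)) /\
    (forall X Y (u : X ~> Y) v,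
       phi X (v \oc u) = phi Y v \oc fmor (shift D) u).
  have [t [t' t'K tK]] := shiftn_succ F n.
  pose p X (v : X ~> G n) := t \oc fmor (shift D) v.
  have plin X : linear (@p X) by move=> a u v; rewrite /p fmorP compPr.
  pose pL X : {linear hom D X (G n) -> hom D (shift D X) (G (n + 1))} :=
    HB.pack (@p X) (GRing.isLinear.Build k (hom D X (G n))
      (hom D (shift D X) (G (n + 1))) *:%R (@p X) (plin X)).
  exists pL.
  split=> [X|X Y u v] /=; last by rewrite /p fmorM compA.
  have surj (w : shift D X ~> G (n + 1)) : exists v, p X v = w.
    have [v vE] := quasi_inverse_surj (t' \oc w) (shiftK D).
    by exists v; rewrite /p vE compA tK comp1m.
  pose q w := sval (cid (surj w)).
  have qK w : p X (q w) = w by rewrite /q; case: cid.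
  have pI : injective (p X).
    move=> v w /(congr1 (fun z => t' \oc z)); rewrite /p !compA t'K !comp1m.
    exact: (quasi_inverse_inj (shiftK D).1).
  by exists q => v //; apply: pI; rewrite qK.
have dA n : d A n = r _ _ f n + r _ _ h (n + 1).
  have [phi [phiB phiN]] := shiftE n.
  rewrite /d (dim_iso (phiB A)) -/(d (shift D A) (n + 1)) dA1; congr (_ + _).
  congr Posz; apply/esym.
  by apply: (lrank_iso _ _ _ _ (phiB B) (phiB A)) => v; exact: phiN.
have bd X : exists N : nat, forall n, (N < `|n|)%N -> d X n = 0.
  have [N N0] := (finD X F).2; exists N => n /N0 h0.
  by rewrite /d dim0 //; exact: fd.
have [NA A0] := bd A; have [NB B0] := bd B; have [NC C0] := bd C.
have r0 (n : int) : (NA + NB + NC < `|n|)%N ->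
    [/\ r _ _ f n = 0, r _ _ g n = 0, r _ _ h n = 0 & r _ _ h (n + 1) = 0].
  move=> lt_n.
  have {A0} : d A n = 0 by apply: A0; lia.
  have {B0} : d B n = 0 by apply: B0; lia.
  have {C0} : d C n = 0 by apply: C0; lia.
  by rewrite dA dB dC /r => ? ? ?; split; lia.
pose S (a : int -> int) := \sum_(n \in [set: int]) (-1) ^+ `|n|%N * a n.
have SD a b : (forall n : int, (NA + NB + NC < `|n|)%N -> a n = 0 /\ b n = 0) ->
    S (fun n => a n + b n) = S a + S b.
  move=> ab0; rewrite -(fsum_split (N := NA + NB + NC)).
    by apply: eq_fsbigr => n _; rewrite mulrDr.
  by move=> n /ab0[-> ->]; rewrite !mulr0.
have Sh : S (fun n => r _ _ h (n + 1)) = - S (r _ _ h).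
  rewrite [S (r _ _ h)](reindex_fsbigT (fun n => n + 1)); last first.
    by exists (fun n => n - 1) => n; rewrite ?addrK ?addrNK.
  rewrite -mulN1r mulr_fsumr; apply: eq_fsbigr => n _.
  by rewrite signZS mulN1r mulNr opprK.
have eE X a : d X =1 a -> euler X F = S a.
  by move=> e; apply: eq_fsbigr => n _; rewrite -e.
rewrite (eE _ _ dA) (eE _ _ dB) (eE _ _ dC) !SD; try by move=> n /r0[].
by rewrite Sh [RHS]addrA addrNK addrC.
Qed.

End EulerAdditive.

Section Grothendieck.
Variables (k : fieldType) (D : tricat k).

Definition freeK : zmodType := {freeg {classic D} / int}.

Definition free_class (E : D) : freeK := << (E : {classic D}) >>.

(* The subgroup generated by the distinguished triangles. *)
Inductive tri_rel : freeK -> Prop :=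
| tri_rel_dist A B C (f : A ~> B) (g : B ~> C) (h : C ~> shift D A) :
    dist f g h -> tri_rel (free_class B - free_class A - free_class C)
| tri_rel0 : tri_rel 0
| tri_relB x y : tri_rel x -> tri_rel y -> tri_rel (x - y).

Definition tri_relb : {pred freeK} := fun x => `[< tri_rel x >].

Lemma tri_relb_closed : zmod_closed tri_relb.
Proof.
split; first exact/asboolP/tri_rel0.
by move=> x y /asboolP xP /asboolP yP; apply/asboolP/tri_relB.
Qed.

HB.instance Definition _ := GRing.isZmodClosed.Build freeK tri_relb
  tri_relb_closed.

Definition K0 : zmodType := Quotient.quot tri_relb.

Definition K0_proj : {additive freeK -> K0} := \pi_(Quotient.quot tri_relb).

Definition K0_class (E : D) : K0 := K0_proj (free_class E).

Variable finD : numerically_finite D.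

(* The Euler pairing with the class of [F], on [freeK] and then on [K0], where
   it is computed on a representative. *)
Definition free_euler (F : D) (x : freeK) : int :=
  fglift (fun E : {classic D} => euler E F : int^o) x.

Definition K0_euler (F : D) (c : K0) : int := free_euler F (repr c).

Lemma free_euler_is_zmod F : zmod_morphism (free_euler F).
Proof. exact: (lift_is_additive (fun E : {classic D} => euler E F : int^o)). Qed.

Lemma free_euler_class (E F : D) : free_euler F (free_class E) = euler E F.
Proof. by rewrite /free_euler liftU scale1r. Qed.

Lemma tri_rel_euler F (x : freeK) : tri_rel x -> free_euler F x = 0.
Proof.
elim=> [A B C f g h /(euler_dist finD F) e||y z _ y0 _ z0].
- by rewrite !free_euler_is_zmod !free_euler_class e addrAC addrK subrr.
- by rewrite -(subrr 0) free_euler_is_zmod subrr.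
- by rewrite free_euler_is_zmod y0 z0 subr0.
Qed.

Lemma K0_eulerE F (x : freeK) : K0_euler F (K0_proj x) = free_euler F x.
Proof.
apply/eqP; rewrite -subr_eq0 -free_euler_is_zmod; apply/eqP/tri_rel_euler.
apply/asboolP; have := Quotient.idealrBE tri_relb (repr (K0_proj x)) x.
by rewrite -[_ \in _]/(`[< tri_rel _ >]) => ->; rewrite reprK.
Qed.

Lemma K0_euler_class (E F : D) : K0_euler F (K0_class E) = euler E F.
Proof. by rewrite K0_eulerE free_euler_class. Qed.

Lemma K0_euler_is_zmod F : zmod_morphism (K0_euler F).
Proof.
move=> c d; rewrite -[c]reprK -[d]reprK -!/(K0_proj _) -raddfB.
by rewrite !K0_eulerE free_euler_is_zmod.
Qed.

(* The left kernel of the Euler pairing; it equals the right kernel when [D]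
   has a Serre functor. Testing against classes of objects is enough, as they
   generate [K0]. *)
Definition euler_ker : {pred K0} := fun c =>
  `[< forall F : D, K0_euler F c = 0 >].

Lemma euler_ker_closed : zmod_closed euler_ker.
Proof.
split=> [|c d /asboolP c0 /asboolP d0]; apply/asboolP => F.
  by rewrite -(subrr 0) K0_euler_is_zmod subrr.
by rewrite K0_euler_is_zmod c0 d0 subr0.
Qed.

HB.instance Definition _ := GRing.isZmodClosed.Build K0 euler_ker
  euler_ker_closed.

Definition Knum : zmodType := Quotient.quot euler_ker.

Definition Knum_proj : {additive K0 -> Knum} := \pi_(Quotient.quot euler_ker).

Definition Knum_class (E : D) : Knum := Knum_proj (K0_class E).

End Grothendieck.

Arguments Knum {k D} _.
Arguments Knum_proj {k D} _.
Arguments Knum_class {k D} _ _.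

(** [tle] and [tge] are D^{<=0} and D^{>=0}; [E] lies in D^{<=n} (resp. D^{>=n})
    when [shiftn n E] lies in [tle] (resp. [tge]). *)

Record tstructure (k : fieldType) (D : tricat k) := TStructure {
  tle : D -> Prop;
  tge : D -> Prop;
  tle_iso : forall A B, isomorphic A B -> tle A -> tle B;
  tge_iso : forall A B, isomorphic A B -> tge A -> tge B;
  tle_shift : forall A, tle A -> tle (shift D A);
  tge_unshift : forall A, tge A -> tge (unshift D A);
  tstr_hom0 : forall A B, tle A -> tge (shift D B) ->
    forall f : A ~> B, f = 0;
  tstr_triangle : forall E, exists (A B : D) (f : A ~> E) (g : E ~> B)
    (h : B ~> shift D A), [/\ dist f g h, tle A & tge (shift D B)]
}.

Section TStructure.
Variables (k : fieldType) (D : tricat k) (t : tstructure D).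

Definition heart (E : D) : Prop := tle t E /\ tge t E.

Definition bounded : Prop :=
  forall E : D, exists a b : int, tle t (shiftn a E) /\ tge t (shiftn b E).

End TStructure.

Section StabilityFunction.
Variable R : realType.
Local Notation C := R[i].
Variables (D : tricat C) (H : D -> Prop) (Z : K0 D -> C).

(* The values r e^{i pi phi} with r > 0 and 0 < phi <= 1. *)
Definition upper_half_plane (z : C) : Prop :=
  0 < complex.Im z \/ (complex.Im z = 0 /\ complex.Re z < 0).

(* For [z] in [upper_half_plane], its argument divided by pi, in ]0, 1]. *)
Definition phase_of (z : C) : R :=
  acos (complex.Re z / Num.sqrt (complex.Re z ^+ 2 + complex.Im z ^+ 2)) / pi.

Definition phase (E : D) : R := phase_of (Z (K0_class E)).

Definition stability_function : Prop :=
  forall E : D, H E -> ~ is_zero E -> upper_half_plane (Z (K0_class E)).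

Definition semistable (E : D) : Prop :=
  [/\ H E, ~ is_zero E &
      forall (A : D) (i : A ~> E), H A -> ~ is_zero A -> mono_in H i ->
        phase A <= phase E].

(* A filtration 0 = F 0 -> ... -> F n = E with semistable factors Q 0, ...,
   Q (n-1) of decreasing phases; values of F and Q beyond n are irrelevant. *)
Definition has_HN_filtration (E : D) : Prop :=
  exists (n : nat) (F Q : nat -> D) (i : forall j, F j ~> F j.+1)
      (p : forall j, F j.+1 ~> Q j),
    [/\ is_zero (F 0%N), F n = E,
        forall j, (j < n)%N ->
          short_exact_in H (i j) (p j) /\ semistable (Q j) &
        forall j, (j.+1 < n)%N -> phase (Q j.+1) < phase (Q j)].

End StabilityFunction.

Record stability_condition (R : realType) (D : tricat R[i]) :=
  StabilityCondition {
    stab_tstr : tstructure D;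
    stab_bounded : bounded stab_tstr;
    central_charge : {additive K0 D -> R[i]};
    stab_positive : stability_function (heart stab_tstr) central_charge;
    stab_HN : forall E : D, heart stab_tstr E -> ~ is_zero E ->
      has_HN_filtration (heart stab_tstr) central_charge E
  }.

Definition numerical (R : realType) (D : tricat R[i])
    (finD : numerically_finite D) (sigma : stability_condition D) : Prop :=
  exists Zn : {additive Knum finD -> R[i]},
    forall c : K0 D, central_charge sigma c = Zn (Knum_proj finD c).

Record tri_subcat (k : fieldType) (D : tricat k) := TriSubcat {
  in_sub :> D -> Prop;
  sub_iso : forall A B, isomorphic A B -> in_sub A -> in_sub B;
  sub_zero : forall Z, is_zero Z -> in_sub Z;
  sub_shift : forall A, in_sub A -> in_sub (shift D A);
  sub_unshift : forall A, in_sub A -> in_sub (unshift D A);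
  sub_cone : forall (A B C : D) (f : A ~> B) (g : B ~> C) (h : C ~> shift D A),
    dist f g h -> in_sub A -> in_sub B -> in_sub C
}.

Section Summands.
Variables (k : fieldType) (D : tricat k).

Definition semiorthogonal_decomposition (D1 D2 : tri_subcat D) : Prop :=
  (forall E1 E2 : D, D1 E1 -> D2 E2 -> forall f : E2 ~> E1, f = 0) /\
  (forall E : D, exists (E2 E1 : D) (f : E2 ~> E) (g : E ~> E1)
     (h : E1 ~> shift D E2), [/\ dist f g h, D2 E2 & D1 E1]).

Definition orthogonal_decomposition (D1 D2 : tri_subcat D) : Prop :=
  semiorthogonal_decomposition D1 D2 /\
  (forall E1 E2 : D, D1 E1 -> D2 E2 -> forall f : E1 ~> E2, f = 0).

Definition phantomic_summand (finD : numerically_finite D)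
    (P : tri_subcat D) : Prop :=
  (exists body : tri_subcat D, orthogonal_decomposition body P) /\
  (forall E : D, P E -> Knum_class finD E = 0).

Definition nonzero_subcat (P : tri_subcat D) : Prop :=
  exists2 E : D, P E & ~ is_zero E.

End Summands.

(* Main.v *)
Require Import Defs.
From mathcomp Require Import all_boot all_order all_algebra.
From mathcomp Require Import reals.
From mathcomp.real_closed Require Import complex.
From mathcomp Require Import boolp.
Import Order.TTheory GRing.Theory Num.Theory.
Set Implicit Arguments.
Unset Strict Implicit.
Unset Printing Implicit Defensive.
Local Open Scope ring_scope.

(** A nonzero phantomic summand [P] would contain a nonzero object of the
    heart; this is absurd, because the central charge of a nonzero object of
    the heart lies in the upper half plane, hence is nonzero, whereas a
    numerical central charge kills an object whose numerical class vanishes.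

    To find that object, start from a nonzero [E] in [P].  By boundedness it
    has a top nonzero cohomology object: some shift [X] of [E] satisfies
    [X[1]] in [D^{<=0}] while [X] is not in [D^{<=0}]
    ([top_degree_exists]).  In the truncation triangle [A -> X -> B -> A[1]]
    the object [B[1]] is then the top cohomology of [X[1]]; it lies in the
    heart and is nonzero ([top_cohomology_heart]).

    It remains in [P] because the truncation functors respect an orthogonal
    decomposition ([truncation_in_summand]): the component of [B] in the other
    summand receives no map from [X], so its projection factors through
    [A[1]], and a map from [A[1]] to a direct summand of [B] is zero by the
    axioms of a t-structure. *)

Section Zero.
Variables (k : fieldType) (D : lincat k).

Lemma is_zeroP (A : D) : is_zero A <-> idm D A = 0.
Proof.
split=> [A0|id0 B]; first exact: (A0 A).1.
by split=> f; [rewrite -[f]compm1 id0 compm0 | rewrite -[f]comp1m id0 comp0m].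
Qed.

Lemma is_zero_iso (A B : D) : isomorphic A B -> is_zero A -> is_zero B.
Proof.
by move=> [f [g _ fg]] A0; apply/is_zeroP; rewrite -fg ((A0 B).2 g) compm0.
Qed.

Lemma isomorphic_sym (A B : D) : isomorphic A B -> isomorphic B A.
Proof. by move=> [f [g gf fg]]; exists g, f. Qed.

End Zero.

Section Triangles.
Variables (k : fieldType) (D : tricat k).
Implicit Types A B C E X Y : D.

Lemma is_zero_of_shift A : is_zero (shift D A) -> is_zero A.
Proof.
move=> /is_zeroP SA0; apply/is_zeroP.
by apply: (quasi_inverse_inj (shiftK D).1); rewrite fmor1 fmor0.
Qed.

Lemma shift_unshift A : isomorphic (shift D (unshift D A)) A.
Proof. by have [_ [eps [epsI _]]] := shiftK D; exists (eps A); exact: epsI. Qed.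

Lemma is_zero_shiftn (n : int) A : is_zero (shiftn n A) -> is_zero A.
Proof.
have unshift0 B : is_zero (unshift D B) -> is_zero B.
  by move=> /(fmor_zero (shift D)); apply/is_zero_iso/shift_unshift.
case: n => n /=; first by elim: n => //= n IHn /is_zero_of_shift.
by move=> /unshift0; elim: n => //= n IHn /unshift0.
Qed.

Lemma sub_shiftn (P : tri_subcat D) (n : int) A : P A -> P (shiftn n A).
Proof.
case: n => n PA /=; first by elim: n => //= n; exact: sub_shift.
by apply: sub_unshift; elim: n => //= n; exact: sub_unshift.
Qed.

(** The retraction of [f] comes from extending the identity of [A[1]] along
    [- f[1]], whose precomposition with the connecting map vanishes, and then
    undoing the shift, which is fully faithful. *)
Lemma dist_split A B C (f : A ~> B) (g : B ~> C) :
  dist f g (0 : C ~> shift D A) ->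
  exists (r : B ~> A) (s : C ~> B),
    r \oc f = idm D A /\ f \oc r + s \oc g = idm D B.
Proof.
move=> fg0.
have [v vf] : exists v, v \oc (- fmor (shift D) f) = idm D (shift D A).
  by apply: (dist_factor ((dist_rot _ _ _).1 ((dist_rot _ _ _).1 fg0)));
    rewrite compm0.
have [r rE] := quasi_inverse_surj (- v) (shiftK D).
have rf : r \oc f = idm D A.
  apply: (quasi_inverse_inj (shiftK D).1).
  by rewrite fmorM rE fmor1 -vf compNm compmN.
have [s sg] : exists s, s \oc g = idm D B + (-1) *: (f \oc r).
  apply: (dist_factor fg0).
  by rewrite addrC compPl comp1m -Defs.compA rf compm1 scaleN1r addNr.
by exists r, s; rewrite sg scaleN1r addrC subrK.
Qed.

Variable t : tstructure D.

(** [D^{<=0}] is the left orthogonal of [D^{>=1}]: on an [X] orthogonal to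
    [D^{>=1}] the truncation map [X -> B] is zero, so [B] is a direct summand
    of [A[1]], which maps to it only by zero. *)
Lemma tle_orthogonal X :
  (forall Y, tge t (shift D Y) -> forall u : X ~> Y, u = 0) -> tle t X.
Proof.
move=> X0; have [A [B [f [g [h [fgh Ale Bge]]]]]] := tstr_triangle t X.
have g0 : g = 0 := X0 B Bge g.
have [v vh] : exists v, v \oc h = idm D B.
  by apply: (dist_factor ((dist_rot _ _ _).1 fgh)); rewrite g0 compm0.
have h0 : h = 0.
  have v0 : v = 0 := tstr_hom0 (tle_shift Ale) Bge v.
  have /is_zeroP B0 : idm D B = 0 by rewrite -vh v0 comp0m.
  exact: (B0 _).1.
rewrite h0 in fgh; have [r [s [rf frsg]]] := dist_split fgh.
apply: tle_iso Ale; exists f, r => //.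
by rewrite -frsg g0 compm0 addr0.
Qed.

(** [B[1]] is the top cohomology of [X[1]].  It is an extension of [X[1]] by
    [A[2]], both in [D^{<=0}]; and if it vanished, [X] would be orthogonal to
    [D^{>=1}] like [A]. *)
Lemma top_cohomology_heart A X B (f : A ~> X) (g : X ~> B)
    (h : B ~> shift D A) :
  dist f g h -> tle t A -> tge t (shift D B) ->
  tle t (shift D X) -> ~ tle t X ->
  heart t (shift D B) /\ ~ is_zero (shift D B).
Proof.
move=> fgh Ale Bge SXle Xnle; split.
  split=> //; apply: tle_orthogonal => Y Yge u.
  (* After four rotations [- g[1]] comes first, followed by [- h[1]] into [A[2]]. *)
  have d := (dist_rot _ _ _).1 ((dist_rot _ _ _).1 ((dist_rot _ _ _).1
    ((dist_rot _ _ _).1 fgh))).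
  have [|v <-] := dist_factor (u := u) d.
    by apply: (tstr_hom0 SXle Yge).
  by rewrite (tstr_hom0 (tle_shift (tle_shift Ale)) Yge v) comp0m.
move=> /is_zero_of_shift B0; apply: Xnle.
apply: tle_orthogonal => Y Yge u.
have [|v <-] := dist_factor (u := u) fgh; first exact: (tstr_hom0 Ale Yge).
by rewrite ((B0 _).1 v) comp0m.
Qed.

(** Otherwise [E[n]] would lie in [D^{<=0}] for every [n]; but some [E[b]]
    lies in [D^{>=0}], and then the identity of [E[b-1]] would be a map from
    [D^{<=0}] to [D^{>=1}]. *)
Lemma top_degree_exists E : bounded t -> ~ is_zero E ->
  exists n : int, tle t (shift D (shiftn n E)) /\ ~ tle t (shiftn n E).
Proof.
move=> tb Enz; apply: contrapT => none.
have down (n : int) : tle t (shiftn (n + 1) E) -> tle t (shiftn n E).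
  move=> nle; apply: contrapT => nnle; apply: none; exists n; split=> //.
  exact: tle_iso (isomorphic_sym (shiftn_succ E n)) nle.
have up (n : int) : tle t (shiftn n E) -> tle t (shiftn (n + 1) E).
  by move=> nle; exact: tle_iso (shiftn_succ E n) (tle_shift nle).
have [a [b [ale bge]]] := tb E.
have allD (m : nat) : tle t (shiftn (a + m%:Z) E) /\ tle t (shiftn (a - m%:Z) E).
  elim: m => [|m [IHu IHd]]; first by rewrite subr0.
  rewrite -addn1 PoszD; split; first by rewrite addrA; exact: up.
  by apply: down; rewrite opprD addrA subrK.
have all n : tle t (shiftn n E).
  rewrite -(subrK a n) addrC; case: (n - a) => m; first exact: (allD m).1.
  by rewrite NegzE; exact: (allD m.+1).2.
apply/Enz/(@is_zero_shiftn (b - 1))/is_zeroP.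
apply: (tstr_hom0 (all (b - 1))).
by apply: tge_iso bge; apply: isomorphic_sym; rewrite -{2}(subrK 1 b);
  exact: shiftn_succ.
Qed.

(** Both orthogonality conditions enter: one makes the decomposition triangle
    of [B] split, the other kills the composite of [g] with the projection [q]
    to the component in [body].  So [q] extends along [h] to [A[1]], and the
    idempotent [s \oc q] of [B] factors through [A[1] -> B], which is zero. *)
Lemma truncation_in_summand (body P : tri_subcat D) A X B
    (f : A ~> X) (g : X ~> B) (h : B ~> shift D A) :
  orthogonal_decomposition body P -> dist f g h ->
  tle t A -> tge t (shift D B) -> P X -> P B.
Proof.
move=> [[PQ0 dec] QP0] fgh Ale Bge PX.
have [BP [BQ [e [q [c [eqc PBP QBQ]]]]]] := dec B.
have c0 : c = 0 by apply: QP0 => //; exact: sub_shift.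
rewrite c0 in eqc; have [r [s [re ersq]]] := dist_split eqc.
have [v vh] : exists v, v \oc h = q.
  by apply: (dist_factor ((dist_rot _ _ _).1 fgh)); exact: PQ0.
have sq0 : s \oc q = 0.
  by rewrite -vh Defs.compA (tstr_hom0 (tle_shift Ale) Bge (s \oc v)) comp0m.
apply: sub_iso PBP; exists e, r => //.
by rewrite -ersq sq0 addr0.
Qed.

Lemma summand_meets_heart (body P : tri_subcat D) :
  bounded t -> orthogonal_decomposition body P -> nonzero_subcat P ->
  exists H, [/\ P H, heart t H & ~ is_zero H].
Proof.
move=> tb dec [E PE Enz]; have [n [SXle Xnle]] := top_degree_exists tb Enz.
have [A [B [f [g [h [fgh Ale Bge]]]]]] := tstr_triangle t (shiftn n E).
have [Bh Bnz] := top_cohomology_heart fgh Ale Bge SXle Xnle.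
exists (shift D B); split=> //; apply: sub_shift.
by apply: (truncation_in_summand dec fgh) => //;
  exact: sub_shiftn.
Qed.

End Triangles.

Theorem lemma6p8 (R : realType) (D : tricat R[i]) (S : serre_functor D)
  (finD : numerically_finite D) (sigma : stability_condition D)
  (sigma_num : numerical finD sigma) :
  ~ exists P : tri_subcat D, phantomic_summand finD P /\ nonzero_subcat P.
Proof.
move=> [P [[[body dec] P0] Pnz]].
have [H [PH Hh Hnz]] :=
  summand_meets_heart (stab_bounded sigma) dec Pnz.
have [Zn ZnE] := sigma_num.
have := stab_positive Hh Hnz.
rewrite ZnE -/(Knum_class finD H) P0 // raddf0.
by case=> [|[_]]; rewrite ltxx.
Qed.
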